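(* Let $\mathcal T_\bullet:I\to 2\text{-}tt\mathcal{C}at$ be a pseudo-functor with $I$ conjoining, let $\mathcal T\in2\text{-}tt\mathcal{C}at$, and let $f:\mathcal T_\bullet\to\mathcal T$ be a pseudo-natural transformation. Assume that $f$ is surjective on morphisms and detects isomorphisms. Then the induced map $$\varphi:=\varprojlim_i f_i^{-1}:\mathrm{Spc}(\mathcal T)\to\varprojlim_i\mathrm{Spc}(\mathcal T_i)$$ is a homeomorphism.
   Context: A tt-category is a triangulated category with a compatible symmetric unital monoidal structure whose product $\otimes$ is exact in each variable; a tt-functor is an exact strong symmetric unital monoidal functor. $2\text{-}tt\mathcal{C}at$ is the 2-category of small tt-categories, tt-functors and tt-isotransformations (natural isomorphisms compatible with the tensor and triangulated structures), with no strictness assumptions. A pseudo-natural transformation $f:\mathcal T_\bullet\to\mathcal T$ is one to the constant pseudo-functor at $\mathcal T$; it consists of tt-functors $f_i:\mathcal T_i\to\mathcal T$ with coherent tt-isomorphisms $f_j\circ\mathcal T_u\cong f_i$ for $u:i\to j$ in $I$. A category $I$ is conjoining if it is non-empty and for any $i,j\in I$ there are $k\in I$ and morphisms $i\to k$, $j\to k$. $f$ is surjective on morphisms if for each morphism $\alpha:a\to b$ in $\mathcal T$ there exist $i\in I$ and a morphism $\alpha_i:a_i\to b_i$ in $\mathcal T_i$ with $f_i(\alpha_i)\cong\alpha$, meaning that there are isomorphisms $a\cong f_i(a_i)$ and $b\cong f_i(b_i)$ identifying $\alpha$ with $f_i(\alpha_i)$. $f$ detects isomorphisms if for all $i\in I$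 and $a_i,b_i\in\mathcal T_i$ with $f_i(a_i)\cong f_i(b_i)$ in $\mathcal T$ there exists $u:i\to j$ in $I$ with $\mathcal T_u(a_i)\cong\mathcal T_u(b_i)$. A tt-ideal of $\mathcal T$ is a thick subcategory $\mathcal I$ with $\mathcal T\otimes\mathcal I\subset\mathcal I$; it is prime if it is proper and $a\otimes b\in\mathcal I$ implies $a\in\mathcal I$ or $b\in\mathcal I$. $\mathrm{Spc}(\mathcal T)$ is the set of prime tt-ideals with the topology with open basis $U(a)=\{\mathfrak P\mid a\in\mathfrak P\}$, $a\in\mathcal T$. A tt-functor $F$ induces a continuous map $\mathfrak P\mapsto F^{-1}(\mathfrak P)$ on $\mathrm{Spc}$, and isomorphic tt-functors induce the same map. The limit is that of the functor $I^{\mathrm{op}}\to\mathrm{Top}$, $i\mapsto\mathrm{Spc}(\mathcal T_i)$, $u\mapsto\mathcal T_u^{-1}$, and $\varphi(\mathfrak P)=(f_i^{-1}(\mathfrak P))_i$. *)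

(* Defs.v *)
From HB Require Import structures.
From mathcomp Require Import all_boot all_order all_algebra.
From mathcomp Require Import all_classical.
From mathcomp Require Import topology.

Set Implicit Arguments.
Unset Strict Implicit.
Unset Printing Implicit Defensive.

Import GRing.Theory.
Local Open Scope classical_set_scope.
Local Open Scope ring_scope.

Declare Scope cat_scope.
Delimit Scope cat_scope with cat.
Local Open Scope cat_scope.

Reserved Notation "g ∘ f" (at level 40, left associativity).
Reserved Notation "a ⊗ b" (at level 38, left associativity).
Reserved Notation "f ⊠ g" (at level 38, left associativity).

Record category := Category {
  obj :> Type;
  hom : obj -> obj -> Type;
  idm : forall a, hom a a;
  comp : forall a b c, hom b c -> hom a b -> hom a c;
  comp1m : forall a b (f : hom a b), comp (idm b) f = f;
  compm1 : forall a b (f : hom a b), comp f (idm a) = f;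
  compA : forall a b c d (h : hom c d) (g : hom b c) (f : hom a b),
    comp h (comp g f) = comp (comp h g) f
}.
Arguments hom {_} _ _.
Arguments idm {_} _.
Arguments comp {_ _ _ _} _ _.
Arguments comp1m {_ _ _} _.
Arguments compm1 {_ _ _} _.
Arguments compA {_ _ _ _ _} _ _ _.
Notation "g ∘ f" := (comp g f) : cat_scope.

Definition is_iso (C : category) (a b : C) (f : hom a b) : Prop :=
  exists g : hom b a, g ∘ f = idm a /\ f ∘ g = idm b.

Definition isomorphic (C : category) (a b : C) : Prop :=
  exists f : hom a b, is_iso f.

Definition eqhom (C : category) (a b : C) (e : a = b) : hom a b :=
  match e in _ = b0 return hom a b0 with erefl => idm a end.

Record functor (C D : category) := Functor {
  fobj :> C -> D;
  fmor : forall a b, hom a b -> hom (fobj a) (fobj b);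
  fmor1 : forall a, fmor (idm a) = idm (fobj a);
  fmorM : forall a b c (g : hom b c) (f : hom a b),
    fmor (g ∘ f) = fmor g ∘ fmor f
}.
Arguments fmor {_ _} _ {_ _} _.

Definition functor_id (C : category) : functor C C :=
  @Functor C C id (fun _ _ f => f) (fun _ => erefl) (fun _ _ _ _ _ => erefl).

Section FunctorComp.
Variables (C D E : category) (G : functor D E) (F : functor C D).

Let fmor_comp a b (f : hom a b) : hom (G (F a)) (G (F b)) := fmor G (fmor F f).

Lemma fmor_comp1 a : fmor_comp (idm a) = idm (G (F a)).
Proof. by rewrite /fmor_comp !fmor1. Qed.

Lemma fmor_compM a b c (g : hom b c) (f : hom a b) :
  fmor_comp (g ∘ f) = fmor_comp g ∘ fmor_comp f.
Proof. by rewrite /fmor_comp !fmorM. Qed.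

Definition functor_comp : functor C E := Functor fmor_comp1 fmor_compM.

End FunctorComp.

Record nat_iso (C D : category) (F G : functor C D) := NatIso {
  nat_iso_map :> forall a : C, hom (F a) (G a);
  nat_iso_is_iso : forall a, is_iso (nat_iso_map a);
  nat_iso_natural : forall a b (f : hom a b),
    nat_iso_map b ∘ fmor F f = fmor G f ∘ nat_iso_map a
}.

Definition is_equivalence (C D : category) (F : functor C D) : Prop :=
  exists G : functor D C,
    inhabited (nat_iso (functor_comp G F) (functor_id C)) /\
    inhabited (nat_iso (functor_comp F G) (functor_id D)).

(* [zmodType] extends [choiceType], so hom-sets need a (classical) choice
   structure before they can be abelian groups. *)
HB.instance Definition _ (C : category) (a b : C) := gen_eqMixin (hom a b).
HB.instance Definition _ (C : category) (a b : C) := gen_choiceMixin (hom a b).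

Record zmod_category := ZmodCategory {
  zmod_cat :> category;
  hom_isZmodule : forall a b : zmod_cat, GRing.isZmodule (hom a b)
}.

HB.instance Definition _ (C : zmod_category) (a b : C) := hom_isZmodule a b.

Section Additive.
Variable C : zmod_category.

Definition is_zero_object (z : C) : Prop :=
  (forall a (f : hom a z), f = 0) /\ (forall a (f : hom z a), f = 0).

Definition is_biproduct (a b c : C) (i1 : hom a c) (i2 : hom b c)
    (p1 : hom c a) (p2 : hom c b) : Prop :=
  [/\ p1 ∘ i1 = idm a, p2 ∘ i2 = idm b, p2 ∘ i1 = 0, p1 ∘ i2 = 0
    & i1 ∘ p1 + i2 ∘ p2 = idm c].

Definition is_direct_sum (a b c : C) : Prop :=
  exists i1 i2 p1 p2, @is_biproduct a b c i1 i2 p1 p2.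

End Additive.

Record additive_category := AdditiveCategory {
  add_cat :> zmod_category;
  comp_addl : forall (a b c : add_cat) (f : hom a b) (g h : hom b c),
    (g + h) ∘ f = g ∘ f + h ∘ f;
  comp_addr : forall (a b c : add_cat) (f g : hom a b) (h : hom b c),
    h ∘ (f + g) = h ∘ f + h ∘ g;
  zero_object_ex : exists z : add_cat, is_zero_object z;
  direct_sum_ex : forall a b : add_cat, exists c, is_direct_sum a b c
}.

Definition is_additive (C D : additive_category) (F : functor C D) : Prop :=
  forall (a b : C) (f g : hom a b), fmor F (f + g) = fmor F f + fmor F g.

(* A triangle a -f-> b -g-> c -h-> shift a is given by its three maps. *)
Record triangulated_category := TriangulatedCategory {
  tri_cat :> additive_category;
  shift : functor tri_cat tri_cat;
  shift_additive : is_additive shift;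
  shift_equivalence : is_equivalence shift;
  distinguished : forall a b c : tri_cat,
    hom a b -> hom b c -> hom c (shift a) -> Prop;
  tr1_id : forall a z : tri_cat, is_zero_object z ->
    distinguished (idm a) (0 : hom a z) (0 : hom z (shift a));
  tr1_iso : forall (a b c a' b' c' : tri_cat)
      (f : hom a b) (g : hom b c) (h : hom c (shift a))
      (f' : hom a' b') (g' : hom b' c') (h' : hom c' (shift a'))
      (u : hom a a') (v : hom b b') (w : hom c c'),
    is_iso u -> is_iso v -> is_iso w ->
    v ∘ f = f' ∘ u -> w ∘ g = g' ∘ v -> fmor shift u ∘ h = h' ∘ w ->
    distinguished f g h -> distinguished f' g' h';
  tr1_cone : forall (a b : tri_cat) (f : hom a b),
    exists c (g : hom b c) (h : hom c (shift a)), distinguished f g h;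
  tr2 : forall (a b c : tri_cat)
      (f : hom a b) (g : hom b c) (h : hom c (shift a)),
    distinguished f g h <-> distinguished g h (- fmor shift f);
  tr3 : forall (a b c a' b' c' : tri_cat)
      (f : hom a b) (g : hom b c) (h : hom c (shift a))
      (f' : hom a' b') (g' : hom b' c') (h' : hom c' (shift a'))
      (u : hom a a') (v : hom b b'),
    distinguished f g h -> distinguished f' g' h' -> v ∘ f = f' ∘ u ->
    exists w : hom c c', w ∘ g = g' ∘ v /\ fmor shift u ∘ h = h' ∘ w;
  tr4 : forall (a b c a' b' c' : tri_cat)
      (f : hom a b) (f1 : hom b c') (f2 : hom c' (shift a))
      (g : hom b c) (g1 : hom c a') (g2 : hom a' (shift b))
      (h1 : hom c b') (h2 : hom b' (shift a)),
    distinguished f f1 f2 -> distinguished g g1 g2 ->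
    distinguished (g ∘ f) h1 h2 ->
    exists (u : hom c' b') (v : hom b' a'),
      [/\ distinguished u v (fmor shift f1 ∘ g2),
          u ∘ f1 = h1 ∘ g, h2 ∘ u = f2, v ∘ h1 = g1
        & g2 ∘ v = fmor shift f ∘ h2]
}.
Arguments shift {_}.
Arguments distinguished {_ _ _ _} _ _ _.

Record is_exact (C D : triangulated_category) (F : functor C D)
    (xi : forall a : C, hom (F (shift a)) (shift (F a))) : Prop := IsExact {
  exact_additive : is_additive F;
  exact_shift_iso : forall a, is_iso (xi a);
  exact_shift_natural : forall (a b : C) (f : hom a b),
    xi b ∘ fmor F (fmor shift f) = fmor shift (fmor F f) ∘ xi a;
  exact_distinguished : forall (a b c : C)
      (f : hom a b) (g : hom b c) (h : hom c (shift a)),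
    distinguished f g h ->
    distinguished (fmor F f) (fmor F g) (xi a ∘ fmor F h)
}.

Record symmetric_monoidal (C : category) := SymmetricMonoidal {
  tens : C -> C -> C;
  tensm : forall a a' b b' : C,
    hom a a' -> hom b b' -> hom (tens a b) (tens a' b');
  one : C;
  assoc : forall a b c, hom (tens (tens a b) c) (tens a (tens b c));
  lunit : forall a, hom (tens one a) a;
  runit : forall a, hom (tens a one) a;
  braid : forall a b, hom (tens a b) (tens b a);
  tensm1 : forall a b, tensm (idm a) (idm b) = idm (tens a b);
  tensmM : forall (a a' a'' b b' b'' : C)
      (f' : hom a' a'') (f : hom a a') (g' : hom b' b'') (g : hom b b'),
    tensm (f' ∘ f) (g' ∘ g) = tensm f' g' ∘ tensm f g;
  assoc_iso : forall a b c, is_iso (assoc a b c);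
  lunit_iso : forall a, is_iso (lunit a);
  runit_iso : forall a, is_iso (runit a);
  assoc_natural : forall (a a' b b' c c' : C)
      (f : hom a a') (g : hom b b') (h : hom c c'),
    assoc a' b' c' ∘ tensm (tensm f g) h = tensm f (tensm g h) ∘ assoc a b c;
  lunit_natural : forall (a a' : C) (f : hom a a'),
    lunit a' ∘ tensm (idm one) f = f ∘ lunit a;
  runit_natural : forall (a a' : C) (f : hom a a'),
    runit a' ∘ tensm f (idm one) = f ∘ runit a;
  braid_natural : forall (a a' b b' : C) (f : hom a a') (g : hom b b'),
    braid a' b' ∘ tensm f g = tensm g f ∘ braid a b;
  pentagon : forall a b c d,
    assoc a b (tens c d) ∘ assoc (tens a b) c d =
    tensm (idm a) (assoc b c d) ∘ assoc a (tens b c) d ∘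
      tensm (assoc a b c) (idm d);
  triangle : forall a b,
    tensm (idm a) (lunit b) ∘ assoc a one b = tensm (runit a) (idm b);
  hexagon : forall a b c,
    assoc b c a ∘ braid a (tens b c) ∘ assoc a b c =
    tensm (idm b) (braid a c) ∘ assoc b a c ∘ tensm (braid a b) (idm c);
  braid_sym : forall a b, braid b a ∘ braid a b = idm (tens a b)
}.
Arguments one {_ _}.

Section TensorFunctors.
Variables (C : category) (M : symmetric_monoidal C) (a : C).

Let ltens_mor b b' (f : hom b b') : hom (tens M a b) (tens M a b') :=
  tensm M (idm a) f.

Lemma ltens_mor1 b : ltens_mor (idm b) = idm _.
Proof. exact: tensm1. Qed.

Lemma ltens_morM b c d (g : hom c d) (f : hom b c) :
  ltens_mor (g ∘ f) = ltens_mor g ∘ ltens_mor f.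
Proof. by rewrite /ltens_mor -tensmM comp1m. Qed.

Definition ltens : functor C C := Functor ltens_mor1 ltens_morM.

Let rtens_mor b b' (f : hom b b') : hom (tens M b a) (tens M b' a) :=
  tensm M f (idm a).

Lemma rtens_mor1 b : rtens_mor (idm b) = idm _.
Proof. exact: tensm1. Qed.

Lemma rtens_morM b c d (g : hom c d) (f : hom b c) :
  rtens_mor (g ∘ f) = rtens_mor g ∘ rtens_mor f.
Proof. by rewrite /rtens_mor -tensmM comp1m. Qed.

Definition rtens : functor C C := Functor rtens_mor1 rtens_morM.

End TensorFunctors.

(* The compatibility axioms between tensor and shift are those of Hovey,
   Palmieri and Strickland, Axiomatic stable homotopy theory, Def. A.2.1,
   without the clause on internal homs. *)
Record ttcat := TTCat {
  tt_tri :> triangulated_category;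
  tt_mon : symmetric_monoidal tt_tri;
  shiftl : forall a b, hom (tens tt_mon (shift a) b) (shift (tens tt_mon a b));
  shiftr : forall a b, hom (tens tt_mon a (shift b)) (shift (tens tt_mon a b));
  rtens_exact : forall b, is_exact (F := rtens tt_mon b) (fun a => shiftl a b);
  ltens_exact : forall a, is_exact (F := ltens tt_mon a) (fun b => shiftr a b);
  shiftl_natural : forall (a b b' : tt_tri) (g : hom b b'),
    shiftl a b' ∘ tensm tt_mon (idm (shift a)) g =
    fmor shift (tensm tt_mon (idm a) g) ∘ shiftl a b;
  shiftr_natural : forall (a a' b : tt_tri) (f : hom a a'),
    shiftr a' b ∘ tensm tt_mon f (idm (shift b)) =
    fmor shift (tensm tt_mon f (idm b)) ∘ shiftr a b;
  shift_braid : forall a b,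
    fmor shift (braid tt_mon a b) ∘ shiftl a b =
    shiftr b a ∘ braid tt_mon (shift a) b;
  shift_runit : forall a,
    fmor shift (runit tt_mon a) ∘ shiftl a one = runit tt_mon (shift a);
  shift_assoc : forall a b c,
    fmor shift (assoc tt_mon a b c) ∘ shiftl (tens tt_mon a b) c ∘
      tensm tt_mon (shiftl a b) (idm c) =
    shiftl a (tens tt_mon b c) ∘ assoc tt_mon (shift a) b c;
  shift_anticommute : forall a b,
    fmor shift (shiftr a b) ∘ shiftl a (shift b) =
    - (fmor shift (shiftl a b) ∘ shiftr (shift a) b)
}.

Notation "a ⊗ b" := (tens (tt_mon _) a b) : cat_scope.
Notation "f ⊠ g" := (tensm (tt_mon _) f g) : cat_scope.
Definition tt1 (T : ttcat) : T := @one _ (tt_mon T).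
Arguments tt1 {T}.

Record ttfunctor (S T : ttcat) := TTFunctor {
  ttf :> functor S T;
  ttf_shift : forall a : S, hom (ttf (shift a)) (shift (ttf a));
  ttf_exact : is_exact ttf_shift;
  ttf_tens : forall a b : S, hom (ttf a ⊗ ttf b) (ttf (a ⊗ b));
  ttf_one : hom tt1 (ttf tt1);
  ttf_tens_iso : forall a b, is_iso (ttf_tens a b);
  ttf_one_iso : is_iso ttf_one;
  ttf_tens_natural : forall (a a' b b' : S) (f : hom a a') (g : hom b b'),
    ttf_tens a' b' ∘ (fmor ttf f ⊠ fmor ttf g) =
    fmor ttf (f ⊠ g) ∘ ttf_tens a b;
  ttf_assoc : forall a b c : S,
    fmor ttf (assoc (tt_mon S) a b c) ∘ ttf_tens (a ⊗ b) c ∘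
      (ttf_tens a b ⊠ idm (ttf c)) =
    ttf_tens a (b ⊗ c) ∘ (idm (ttf a) ⊠ ttf_tens b c) ∘
      assoc (tt_mon T) (ttf a) (ttf b) (ttf c);
  ttf_lunit : forall a : S,
    fmor ttf (lunit (tt_mon S) a) ∘ ttf_tens tt1 a ∘ (ttf_one ⊠ idm (ttf a)) =
    lunit (tt_mon T) (ttf a);
  ttf_runit : forall a : S,
    fmor ttf (runit (tt_mon S) a) ∘ ttf_tens a tt1 ∘ (idm (ttf a) ⊠ ttf_one) =
    runit (tt_mon T) (ttf a);
  ttf_braid : forall a b : S,
    fmor ttf (braid (tt_mon S) a b) ∘ ttf_tens a b =
    ttf_tens b a ∘ braid (tt_mon T) (ttf a) (ttf b)
}.

Record ttiso (S T : ttcat) (F G : ttfunctor S T) := TTIso {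
  tti :> nat_iso F G;
  tti_shift : forall a : S,
    fmor shift (tti a) ∘ ttf_shift F a = ttf_shift G a ∘ tti (shift a);
  tti_tens : forall a b : S,
    tti (a ⊗ b) ∘ ttf_tens F a b = ttf_tens G a b ∘ (tti a ⊠ tti b);
  tti_one : tti tt1 ∘ ttf_one F = ttf_one G
}.

Section IsoLemmas.
Variable C : category.

Lemma is_iso_id (a : C) : is_iso (idm a).
Proof. by exists (idm a); rewrite comp1m. Qed.

Lemma is_iso_comp (a b c : C) (g : hom b c) (f : hom a b) :
  is_iso g -> is_iso f -> is_iso (g ∘ f).
Proof.
move=> [g' [g'g gg']] [f' [f'f ff']]; exists (f' ∘ g'); split.
  by rewrite compA -(compA f') g'g compm1.
by rewrite compA -(compA g) ff' compm1.
Qed.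

Lemma is_iso_fmor (D : category) (F : functor C D) (a b : C) (f : hom a b) :
  is_iso f -> is_iso (fmor F f).
Proof.
by move=> [g [gf fg]]; exists (fmor F g); rewrite -!fmorM gf fg !fmor1.
Qed.

End IsoLemmas.

Section TTFunctorId.
Variable T : ttcat.

Let F := functor_id T.

Lemma ttid_exact : is_exact (F := F) (fun a => idm (shift a)).
Proof.
split=> //= [a|a b f|a b c f g h dist]; first exact: is_iso_id.
  by rewrite comp1m compm1.
by rewrite comp1m.
Qed.

Definition ttfunctor_id : ttfunctor T T.
Proof.
refine (@TTFunctor T T F _ ttid_exact (fun a b => idm (a ⊗ b)) (idm tt1)
  _ _ _ _ _ _ _) => /=.
- by move=> a b; exact: is_iso_id.
- exact: is_iso_id.
- by move=> a a' b b' f g; rewrite comp1m compm1.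
- by move=> a b c; rewrite !tensm1 !compm1 comp1m.
- by move=> a; rewrite !tensm1 !compm1.
- by move=> a; rewrite !tensm1 !compm1.
- by move=> a b; rewrite compm1 comp1m.
Defined.

End TTFunctorId.

Section TTFunctorComp.
Variables (R S T : ttcat) (G : ttfunctor S T) (F : ttfunctor R S).

Let GF : functor R T := functor_comp G F.
Let gf_shift (a : R) : hom (GF (shift a)) (shift (GF a)) :=
  ttf_shift G (F a) ∘ fmor G (ttf_shift F a).
Let gf_tens (a b : R) : hom (GF a ⊗ GF b) (GF (a ⊗ b)) :=
  fmor G (ttf_tens F a b) ∘ ttf_tens G (F a) (F b).
Let gf_one : hom tt1 (GF tt1) := fmor G (ttf_one F) ∘ ttf_one G.

Lemma ttcomp_exact : is_exact gf_shift.
Proof.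
split.
- move=> a b f g /=.
  by rewrite (exact_additive (ttf_exact F)) (exact_additive (ttf_exact G)).
- move=> a; apply: is_iso_comp; first exact: (exact_shift_iso (ttf_exact G)).
  by apply: is_iso_fmor; exact: (exact_shift_iso (ttf_exact F)).
- move=> a b f; rewrite /gf_shift /= -compA -fmorM.
  rewrite (exact_shift_natural (ttf_exact F)) fmorM compA.
  by rewrite (exact_shift_natural (ttf_exact G)) -compA.
- move=> a b c f g h /(exact_distinguished (ttf_exact F)).
  by move=> /(exact_distinguished (ttf_exact G)); rewrite fmorM compA.
Qed.

Lemma ttcomp_assoc (a b c : R) :
  fmor GF (assoc (tt_mon R) a b c) ∘ gf_tens (a ⊗ b) c ∘
    (gf_tens a b ⊠ idm (GF c)) =
  gf_tens a (b ⊗ c) ∘ (idm (GF a) ⊠ gf_tens b c) ∘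
    assoc (tt_mon T) (GF a) (GF b) (GF c).
Proof.
rewrite /gf_tens /=.
have -> : (fmor G (ttf_tens F a b) ∘ ttf_tens G (F a) (F b)) ⊠ idm (G (F c)) =
    (fmor G (ttf_tens F a b) ⊠ fmor G (idm (F c))) ∘
    (ttf_tens G (F a) (F b) ⊠ idm (G (F c))).
  by rewrite -tensmM fmor1 comp1m.
have -> : idm (G (F a)) ⊠ (fmor G (ttf_tens F b c) ∘ ttf_tens G (F b) (F c)) =
    (fmor G (idm (F a)) ⊠ fmor G (ttf_tens F b c)) ∘
    (idm (G (F a)) ⊠ ttf_tens G (F b) (F c)).
  by rewrite -tensmM fmor1 comp1m.
rewrite !compA -(compA _ (ttf_tens G _ _) (_ ⊠ _)) ttf_tens_natural.
rewrite -(compA _ (ttf_tens G (F a) (F (b ⊗ c)))) ttf_tens_natural.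
rewrite !compA -!fmorM ttf_assoc !fmorM.
by rewrite -!compA; congr (_ ∘ (_ ∘ _)); rewrite !compA ttf_assoc.
Qed.

Lemma ttcomp_lunit (a : R) :
  fmor GF (lunit (tt_mon R) a) ∘ gf_tens tt1 a ∘ (gf_one ⊠ idm (GF a)) =
  lunit (tt_mon T) (GF a).
Proof.
rewrite /gf_tens /gf_one /= -(ttf_lunit G) -(ttf_lunit F) !fmorM.
have -> : (fmor G (ttf_one F) ∘ ttf_one G) ⊠ idm (G (F a)) =
    (fmor G (ttf_one F) ⊠ fmor G (idm (F a))) ∘ (ttf_one G ⊠ idm (G (F a))).
  by rewrite -tensmM fmor1 comp1m.
rewrite -!compA; congr (_ ∘ (_ ∘ _)).
by rewrite !compA ttf_tens_natural.
Qed.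

Lemma ttcomp_runit (a : R) :
  fmor GF (runit (tt_mon R) a) ∘ gf_tens a tt1 ∘ (idm (GF a) ⊠ gf_one) =
  runit (tt_mon T) (GF a).
Proof.
rewrite /gf_tens /gf_one /= -(ttf_runit G) -(ttf_runit F) !fmorM.
have -> : idm (G (F a)) ⊠ (fmor G (ttf_one F) ∘ ttf_one G) =
    (fmor G (idm (F a)) ⊠ fmor G (ttf_one F)) ∘ (idm (G (F a)) ⊠ ttf_one G).
  by rewrite -tensmM fmor1 comp1m.
rewrite -!compA; congr (_ ∘ (_ ∘ _)).
by rewrite !compA ttf_tens_natural.
Qed.

Definition ttfunctor_comp : ttfunctor R T.
Proof.
refine (@TTFunctor R T GF gf_shift ttcomp_exact gf_tens gf_one
  _ _ _ ttcomp_assoc ttcomp_lunit ttcomp_runit _).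
- move=> a b; apply: is_iso_comp; last exact: ttf_tens_iso.
  by apply: is_iso_fmor; exact: ttf_tens_iso.
- apply: is_iso_comp; last exact: ttf_one_iso.
  by apply: is_iso_fmor; exact: ttf_one_iso.
- move=> a a' b b' f g; rewrite /gf_tens /= -compA ttf_tens_natural !compA.
  by rewrite -!fmorM ttf_tens_natural.
- move=> a b; rewrite /gf_tens /= compA -fmorM ttf_braid fmorM.
  by rewrite -compA ttf_braid compA.
Defined.

End TTFunctorComp.

(* The coherence axioms involve the equalities [comp1m], [compm1] and [compA]
   between morphisms of I, along which [eqhom] transports. *)
Record pseudofunctor (I : category) := Pseudofunctor {
  pf_obj :> I -> ttcat;
  pf_mor : forall i j : I, hom i j -> ttfunctor (pf_obj i) (pf_obj j);
  pf_id : forall i : I, ttiso (ttfunctor_id (pf_obj i)) (pf_mor (idm i));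
  pf_comp : forall (i j k : I) (v : hom j k) (u : hom i j),
    ttiso (ttfunctor_comp (pf_mor v) (pf_mor u)) (pf_mor (v ∘ u));
  pf_comp1m : forall (i j : I) (u : hom i j) (a : pf_obj i),
    eqhom (congr1 (fun w => pf_mor w a) (comp1m u)) ∘
      pf_comp (idm j) u a ∘ pf_id j (pf_mor u a) = idm (pf_mor u a);
  pf_compm1 : forall (i j : I) (u : hom i j) (a : pf_obj i),
    eqhom (congr1 (fun w => pf_mor w a) (compm1 u)) ∘
      pf_comp u (idm i) a ∘ fmor (pf_mor u) (pf_id i a) = idm (pf_mor u a);
  pf_compA : forall (i j k l : I) (w : hom k l) (v : hom j k) (u : hom i j)
      (a : pf_obj i),
    eqhom (congr1 (fun x => pf_mor x a) (compA w v u)) ∘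
      pf_comp w (v ∘ u) a ∘ fmor (pf_mor w) (pf_comp v u a) =
    pf_comp (w ∘ v) u a ∘ pf_comp w v (pf_mor u a)
}.
Arguments pf_mor {_} _ {_ _} _.
Arguments pf_comp {_} _ {_ _ _} _ _.

(* A pseudo-natural transformation to the constant pseudo-functor at T. *)
Record pseudococone (I : category) (TT : pseudofunctor I) (T : ttcat) :=
    Pseudococone {
  pc_obj :> forall i : I, ttfunctor (TT i) T;
  pc_mor : forall (i j : I) (u : hom i j),
    ttiso (ttfunctor_comp (pc_obj j) (pf_mor TT u)) (pc_obj i);
  pc_id : forall (i : I) (a : TT i),
    pc_mor (idm i) a ∘ fmor (pc_obj i) (pf_id TT i a) = idm (pc_obj i a);
  pc_comp : forall (i j k : I) (v : hom j k) (u : hom i j) (a : TT i),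
    pc_mor (v ∘ u) a ∘ fmor (pc_obj k) (pf_comp TT v u a) =
    pc_mor u a ∘ pc_mor v (pf_mor TT u a)
}.
Arguments pc_mor {_ _ _} _ {_ _} _.

Definition conjoining (I : category) : Prop :=
  inhabited I /\
  forall i j : I, exists k : I, inhabited (hom i k) /\ inhabited (hom j k).

Section Hypotheses.
Variables (I : category) (TT : pseudofunctor I) (T : ttcat).
Variable f : pseudococone TT T.

Definition surjective_on_morphisms : Prop :=
  forall (a b : T) (alpha : hom a b),
  exists (i : I) (ai bi : TT i) (alphai : hom ai bi)
    (p : hom a (f i ai)) (q : hom b (f i bi)),
  [/\ is_iso p, is_iso q & q ∘ alpha = fmor (f i) alphai ∘ p].

Definition detects_isomorphisms : Prop :=
  forall (i : I) (ai bi : TT i), isomorphic (f i ai) (f i bi) ->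
  exists (j : I) (u : hom i j),
    isomorphic (pf_mor TT u ai) (pf_mor TT u bi).

End Hypotheses.

Record is_thick (T : triangulated_category) (P : set T) : Prop := IsThick {
  thick_iso : forall a b : T, isomorphic a b -> P a -> P b;
  thick_zero : forall z : T, is_zero_object z -> P z;
  thick_sum : forall a b c : T, is_direct_sum a b c -> P a -> P b -> P c;
  thick_shift : forall a : T, P (shift a) <-> P a;
  thick_cone : forall (a b c : T)
      (f : hom a b) (g : hom b c) (h : hom c (shift a)),
    distinguished f g h -> P a -> P b -> P c;
  thick_summand : forall a b c : T, is_direct_sum a b c -> P c -> P a /\ P b
}.

Record is_tt_ideal (T : ttcat) (P : set T) : Prop := IsTTIdeal {
  ideal_thick : is_thick P;
  ideal_tens : forall a b : T, P b -> P (a ⊗ b)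
}.

Record is_prime (T : ttcat) (P : set T) : Prop := IsPrime {
  prime_ideal : is_tt_ideal P;
  prime_proper : P != setT;
  prime_tens : forall a b : T, P (a ⊗ b) -> P a \/ P b
}.

Record Spc (T : ttcat) := MkSpc {
  spc_set :> set T;
  spc_prime : is_prime spc_set
}.

Lemma Spc_eq (T : ttcat) (P Q : Spc T) :
  (forall a, spc_set P a <-> spc_set Q a) -> P = Q.
Proof.
case: P Q => P Pp [Q Qp] /= PQ.
have eqPQ : P = Q by apply/seteqP; split=> a /PQ.
by subst Q; rewrite (Prop_irrelevance Pp Qp).
Qed.

HB.instance Definition _ (T : ttcat) := gen_eqMixin (Spc T).
HB.instance Definition _ (T : ttcat) := gen_choiceMixin (Spc T).

Definition SpcU (T : ttcat) (a : T) : set (Spc T) := [set P | spc_set P a].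

Section SpcTopology.
Variable T : ttcat.

Lemma SpcU_cover : \bigcup_(A in range (@SpcU T)) id A = setT.
Proof.
apply/seteqP; split=> // P _; have [z z0] := zero_object_ex T.
exists (SpcU z); first by exists z.
exact: (thick_zero (ideal_thick (prime_ideal (spc_prime P)))).
Qed.

Lemma SpcU_join (A B : set (Spc T)) P :
  range (@SpcU T) A -> range (@SpcU T) B -> id A P -> id B P ->
  exists K, [/\ range (@SpcU T) K, id K P & id K `<=` id A `&` id B].
Proof.
move=> [a _ <-] [b _ <-] /= Pa Pb; have [c abc] := direct_sum_ex a b.
exists (SpcU c); split; first by exists c.
  exact: (thick_sum (ideal_thick (prime_ideal (spc_prime P))) abc).
move=> Q /(thick_summand (ideal_thick (prime_ideal (spc_prime Q))) abc).
by case.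
Qed.

HB.instance Definition _ :=
  isBaseTopological.Build (Spc T) SpcU_cover SpcU_join.

Lemma Spc_openP (A : set (Spc T)) :
  open A <-> exists D : set T, A = \bigcup_(a in D) SpcU a.
Proof.
split=> [[B BU <-]|[D ->]].
  exists (@SpcU T @^-1` B); apply/seteqP; split=> P.
    by move=> [K BK KP]; have [a _ aK] := BU _ BK; subst K; exists a.
  by move=> [a Ba Pa]; exists (SpcU a).
exists (@SpcU T @` D); first by move=> _ [a _ <-]; exists a.
apply/seteqP; split=> P; first by move=> [_ [a Da <-] Pa]; exists a.
by move=> [a Da Pa]; exists (SpcU a) => //; exists a.
Qed.

End SpcTopology.

Section SpcMap.
Variables (S T : ttcat) (F : ttfunctor S T).

Lemma ttf_is_zero_object z : is_zero_object z -> is_zero_object (F z).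
Proof.
move=> [z0 _].
have F0 (a b : S) : fmor F (0 : hom a b) = 0.
  by apply: (addrI (fmor F 0)); rewrite -(exact_additive (ttf_exact F)) !addr0.
have id0 : idm (F z) = 0 by rewrite -fmor1 (z0 _ (idm z)) F0.
have comp0 a b c (g : hom b c) : g ∘ (0 : hom a b) = 0 :> hom (_ : T) _.
  by apply: (addrI (g ∘ 0)); rewrite -comp_addr !addr0.
have comp0l a b c (g : hom a b) : (0 : hom b c) ∘ g = 0 :> hom (_ : T) _.
  by apply: (addrI (0 ∘ g)); rewrite -comp_addl !addr0.
split=> a f; first by rewrite -[f]comp1m id0 comp0l.
by rewrite -[f]compm1 id0 comp0.
Qed.

Lemma ttf_is_direct_sum a b c :
  is_direct_sum a b c -> is_direct_sum (F a) (F b) (F c).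
Proof.
have F0 (x y : S) : fmor F (0 : hom x y) = 0.
  by apply: (addrI (fmor F 0)); rewrite -(exact_additive (ttf_exact F)) !addr0.
move=> [i1 [i2 [p1 [p2 [p1i1 p2i2 p2i1 p1i2 ip]]]]].
exists (fmor F i1), (fmor F i2), (fmor F p1), (fmor F p2).
split; rewrite -!fmorM ?p1i1 ?p2i2 ?p2i1 ?p1i2 ?fmor1 ?F0 //.
by rewrite -(exact_additive (ttf_exact F)) ip fmor1.
Qed.

Lemma preimage_prime (P : Spc T) : is_prime [set a | spc_set P (F a)].
Proof.
case: P => P [[[Piso P0 Psum Pshift Pcone Psummand] Ptens] Pproper Pprime] /=.
have iso_sym (a b : T) (g : hom a b) : is_iso g -> isomorphic b a.
  by move=> [h [hg gh]]; exists h, g.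
split; [split; [split|]| |] => /=.
- by move=> a b [g giso]; apply: Piso; exists (fmor F g); exact: is_iso_fmor.
- by move=> z /ttf_is_zero_object; exact: P0.
- by move=> a b c /ttf_is_direct_sum; exact: Psum.
- move=> a; rewrite -(Pshift (F a)); have xi := exact_shift_iso (ttf_exact F) a.
  split; apply: Piso; first by exists (ttf_shift F a).
  exact: iso_sym xi.
- move=> a b c f g h /(exact_distinguished (ttf_exact F)); exact: Pcone.
- by move=> a b c /ttf_is_direct_sum; exact: Psummand.
- move=> a b Pb; apply: (Piso (F a ⊗ F b)); last exact: Ptens.
  by exists (ttf_tens F a b); exact: ttf_tens_iso.
- apply: contra_neq Pproper => PT; apply/seteqP; split=> // a _.
  have P1 : P tt1.
    apply: (Piso (F tt1)); first exact: iso_sym (ttf_one_iso F).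
    by have : [set a | P (F a)] tt1 by rewrite PT.
  apply: (Piso (a ⊗ tt1)); last exact: Ptens.
  by exists (runit (tt_mon T) a); exact: runit_iso.
- move=> a b Pab; apply: Pprime; apply: Piso Pab.
  exact: iso_sym (ttf_tens_iso F a b).
Qed.

Definition Spc_map (P : Spc T) : Spc S := MkSpc (preimage_prime P).

Lemma Spc_map_continuous : continuous Spc_map.
Proof.
apply/continuousP => A /Spc_openP[D ->]; apply/Spc_openP; exists (F @` D).
by rewrite bigcup_image preimage_bigcup.
Qed.

End SpcMap.

Lemma Spc_map_iso (S T : ttcat) (F G : ttfunctor S T) (t : ttiso F G) :
  Spc_map F = Spc_map G.
Proof.
apply/funext => P; apply: Spc_eq => a /=.
have Piso := thick_iso (ideal_thick (prime_ideal (spc_prime P))).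
have [g [gt tg]] := nat_iso_is_iso t a.
by split; apply: Piso; [exists (t a); exists g | exists g; exists (t a)].
Qed.

Lemma Spc_map_id (T : ttcat) : Spc_map (ttfunctor_id T) = id.
Proof. by apply/funext => P; apply: Spc_eq. Qed.

Lemma Spc_map_comp (R S T : ttcat) (G : ttfunctor S T) (F : ttfunctor R S) :
  Spc_map (ttfunctor_comp G F) = Spc_map F \o Spc_map G.
Proof. by apply/funext => P; apply: Spc_eq. Qed.

Section SpcLimit.
Variables (I : category) (TT : pseudofunctor I).

Lemma Spc_pf_id (i : I) : Spc_map (pf_mor TT (idm i)) = id.
Proof. by rewrite -(Spc_map_iso (pf_id TT i)) Spc_map_id. Qed.

Lemma Spc_pf_comp (i j k : I) (v : hom j k) (u : hom i j) :
  Spc_map (pf_mor TT (v ∘ u)) =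
  Spc_map (pf_mor TT u) \o Spc_map (pf_mor TT v).
Proof. by rewrite -(Spc_map_iso (pf_comp TT v u)) Spc_map_comp. Qed.

Definition compatible_primes : set (prod_topology (fun i : I => Spc (TT i))) :=
  [set x | forall (i j : I) (u : hom i j), Spc_map (pf_mor TT u) (x j) = x i].

(* The limit in Top: the subspace of the product consisting of the compatible
   families. *)
Definition Spc_lim : topologicalType := set_type compatible_primes.

Variables (T : ttcat) (f : pseudococone TT T).

Lemma Spc_map_compatible (P : Spc T) :
  (fun i => Spc_map (f i) P) \in compatible_primes.
Proof.
apply/mem_set => i j u.
by rewrite -(Spc_map_iso (pc_mor f u)) Spc_map_comp.
Qed.

Definition Spc_lim_map (P : Spc T) : Spc_lim :=
  exist (fun x => x \in compatible_primes) _ (Spc_map_compatible P).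

End SpcLimit.

Definition is_homeomorphism (X Y : topologicalType) (h : X -> Y) : Prop :=
  exists g : Y -> X, [/\ cancel h g, cancel g h, continuous h & continuous g].

(* Main.v *)
From mathcomp Require Import all_boot all_algebra.
From mathcomp Require Import all_classical.
From mathcomp Require Import topology.
Require Import Defs.

(** A compatible family [x] of primes comes from the single prime of all [a]
    isomorphic to some [f i c] with [c] in [x i].  Detection of isomorphisms
    makes membership independent of the choice of [i] and [c], so the axioms of
    a prime can be checked on lifts.  Finitely many objects lift to a common
    index because [I] is conjoining; lifting morphisms is needed only for
    closure under cones. *)

Set Implicit Arguments.
Unset Strict Implicit.
Unset Printing Implicit Defensive.

Import GRing.Theory.
Local Open Scope classical_set_scope.
Local Open Scope ring_scope.
Local Open Scope cat_scope.

(** * Isomorphic objects in a category *)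

Section Isomorphic.
Variable C : category.
Implicit Types a b c : C.

Lemma isomorphic_refl a : isomorphic a a.
Proof. by exists (idm a); exact: is_iso_id. Qed.

Lemma isomorphic_sym a b : isomorphic a b -> isomorphic b a.
Proof. by move=> [f [g [gf fg]]]; exists g, f. Qed.

Lemma isomorphic_trans a b c :
  isomorphic a b -> isomorphic b c -> isomorphic a c.
Proof. by move=> [f ?] [g ?]; exists (g ∘ f); exact: is_iso_comp. Qed.

(** The hypotheses give [f] a left inverse [k ∘ g] and a right inverse [h ∘ l], and these must
    agree. *)
Lemma is_iso_left_right a b (f : hom a b) (g h : hom b a) :
  is_iso (g ∘ f) -> is_iso (f ∘ h) -> is_iso f.
Proof.
move=> [k [kgf _]] [l [_ fhl]]; exists (k ∘ g); split; first by rewrite -compA.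
have -> : k ∘ g = h ∘ l.
  by rewrite -[k ∘ g]compm1 -fhl !compA -(compA k) kgf comp1m.
by rewrite compA.
Qed.

Lemma isomorphic_fobj (D : category) (F : functor C D) a b :
  isomorphic a b -> isomorphic (F a) (F b).
Proof. by move=> [f ?]; exists (fmor F f); exact: is_iso_fmor. Qed.

Lemma isomorphic_tens (M : symmetric_monoidal C) a a' b b' :
  isomorphic a a' -> isomorphic b b' ->
  isomorphic (tens M a b) (tens M a' b').
Proof.
move=> [f [f' [f'f ff']]] [g [g' [g'g gg']]].
exists (tensm M f g), (tensm M f' g').
by rewrite -!tensmM f'f ff' g'g gg' !tensm1.
Qed.

End Isomorphic.

(** * Zero objects, direct sums and unipotent maps in additive categories *)

Section AdditiveCategory.
Variable C : additive_category.
Implicit Types a b c : C.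

Lemma comp0m a b c (f : hom a b) : (0 : hom b c) ∘ f = 0.
Proof. by apply: (addrI (0 ∘ f)); rewrite -comp_addl !addr0. Qed.

Lemma compm0 a b c (g : hom b c) : g ∘ (0 : hom a b) = 0.
Proof. by apply: (addrI (g ∘ 0)); rewrite -comp_addr !addr0. Qed.

Lemma compNm a b c (g : hom b c) (f : hom a b) : (- g) ∘ f = - (g ∘ f).
Proof. by apply: (addrI (g ∘ f)); rewrite -comp_addl !subrr comp0m. Qed.

Lemma compmN a b c (g : hom b c) (f : hom a b) : g ∘ (- f) = - (g ∘ f).
Proof. by apply: (addrI (g ∘ f)); rewrite -comp_addr !subrr compm0. Qed.

Lemma is_zero_object_idm0 a : idm a = 0 -> is_zero_object a.
Proof.
move=> a0; split=> b f; first by rewrite -[f]comp1m a0 comp0m.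
by rewrite -[f]compm1 a0 compm0.
Qed.

Lemma zero_object_isomorphic a b :
  is_zero_object a -> is_zero_object b -> isomorphic a b.
Proof.
move=> [a0 _] [b0 _]; exists 0, 0.
by rewrite !comp0m (a0 a (idm a)) (b0 b (idm b)).
Qed.

(** The diagonal matrices with entries [u], [v] and [u'], [v'] are inverse to each other. *)
Lemma is_direct_sum_iso a b c a' b' c' : isomorphic a a' -> isomorphic b b' ->
  is_direct_sum a b c -> is_direct_sum a' b' c' -> isomorphic c c'.
Proof.
move=> [u [u' [u'u uu']]] [v [v' [v'v vv']]].
move=> [i1 [i2 [p1 [p2 [p1i1 p2i2 p2i1 p1i2 ip]]]]].
move=> [j1 [j2 [q1 [q2 [q1j1 q2j2 q2j1 q1j2 jq]]]]].
exists (j1 ∘ u ∘ p1 + j2 ∘ v ∘ p2), (i1 ∘ u' ∘ q1 + i2 ∘ v' ∘ q2).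
split; rewrite !comp_addl !comp_addr -!compA.
- rewrite !(compA q1) !(compA q2) q1j1 q2j2 q2j1 q1j2 !comp0m !compm0.
  by rewrite !comp1m !(compA u') !(compA v') u'u v'v !comp1m addr0 add0r.
- rewrite !(compA p1) !(compA p2) p1i1 p2i2 p2i1 p1i2 !comp0m !compm0.
  by rewrite !comp1m !(compA u) !(compA v) uu' vv' !comp1m addr0 add0r.
Qed.

Lemma is_iso_square0 a (e : hom a a) : e ∘ e = 0 -> is_iso (idm a + e).
Proof.
move=> ee; exists (idm a - e).
rewrite !comp_addl !comp_addr !(compNm, compmN, comp1m, compm1) ee.
by rewrite oppr0 !addr0 addrK subrK.
Qed.

End AdditiveCategory.

Lemma additive_zero_object (C D : additive_category) (F : functor C D) (a : C) :
  is_additive F -> is_zero_object a -> is_zero_object (F a).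
Proof.
move=> Fadd [a0 _]; apply: is_zero_object_idm0.
rewrite -fmor1 (a0 a (idm a)); apply: (addrI (fmor F (0 : hom a a))).
by rewrite -Fadd !addr0.
Qed.

(** * Uniqueness of cones *)

Section Triangles.
Variable T : triangulated_category.
Implicit Types a b c x : T.

Lemma distinguished_weak_cokernel a b c x
    (f : hom a b) (g : hom b c) (h : hom c (shift a)) (e : hom c x) :
  distinguished f g h -> e ∘ g = 0 -> exists t, e = t ∘ h.
Proof.
move=> /tr2 gh eg; have [z z0] := zero_object_ex T.
have sz0 : is_zero_object (shift z).
  exact: additive_zero_object (@shift_additive T) z0.
(* This triangle is a rotation of the identity triangle on [x]. By TR3, [e] then extends to a
   morphism into it from the rotated triangle, with third component [t]. *)
have zxx : distinguished (0 : hom z x) (idm x) (0 : hom x (shift z)).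
  by apply/tr2; rewrite (proj2 sz0 _ (- _)); exact: tr1_id.
have [|t [te _]] := tr3 (u := (0 : hom b z)) (v := e) gh zxx.
  by rewrite eg comp0m.
by exists t; rewrite te comp1m.
Qed.

(* [k - idm c] squares to zero: it kills [g], so it factors through [h], which
   it is killed by. *)
Lemma distinguished_endo_iso a b c
    (f : hom a b) (g : hom b c) (h : hom c (shift a)) (k : hom c c) :
  distinguished f g h -> k ∘ g = g -> h ∘ k = h -> is_iso k.
Proof.
move=> fgh kg hk; rewrite -[k](subrK (idm c)) addrC.
apply: is_iso_square0.
have [|t kt] := distinguished_weak_cokernel (e := k - idm c) fgh.
  by rewrite comp_addl compNm comp1m kg subrr.
by rewrite {1}kt -compA comp_addr compmN compm1 hk subrr compm0.
Qed.

(** TR3, applied to [u], [v] and to their inverses, gives maps [w] and [w'] between the cones. Their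
    composites need not be identities, but they are compatible with the other maps of the triangles,
    hence invertible by [distinguished_endo_iso]. *)
Lemma distinguished_cone_iso a b c a' b' c'
    (f : hom a b) (g : hom b c) (h : hom c (shift a))
    (f' : hom a' b') (g' : hom b' c') (h' : hom c' (shift a'))
    (u : hom a a') (v : hom b b') :
  distinguished f g h -> distinguished f' g' h' ->
  is_iso u -> is_iso v -> v ∘ f = f' ∘ u -> isomorphic c c'.
Proof.
move=> fgh fgh' [u' [u'u uu']] [v' [v'v vv']] vf.
have vf' : v' ∘ f' = f ∘ u'.
  by rewrite -[f']compm1 -uu' (compA f') -vf !compA v'v comp1m.
have [w [wg hw]] := tr3 fgh fgh' vf.
have [w' [wg' hw']] := tr3 fgh' fgh vf'.
exists w; apply: (@is_iso_left_right _ _ _ w w' w').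
- apply: (distinguished_endo_iso fgh).
    by rewrite -compA wg compA wg' -compA v'v compm1.
  by rewrite compA -hw' -compA -hw compA -fmorM u'u fmor1 comp1m.
- apply: (distinguished_endo_iso fgh').
    by rewrite -compA wg' compA wg -compA vv' compm1.
  by rewrite compA -hw -compA -hw' compA -fmorM uu' fmor1 comp1m.
Qed.

End Triangles.

(** * The prime glued from a compatible family *)

Section GluedPrime.
Variables (I : category) (TT : pseudofunctor I) (T : ttcat).
Variable f : pseudococone TT T.
Hypotheses (Iconj : conjoining I) (fsurj : surjective_on_morphisms f).
Hypothesis fdet : detects_isomorphisms f.

Lemma isomorphic_pf_mor (i j : I) (u : hom i j) (c : TT i) :
  isomorphic (f j (pf_mor TT u c)) (f i c).
Proof. by exists (pc_mor f u c); exact: (nat_iso_is_iso (pc_mor f u) c). Qed.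

(** Surjectivity on objects follows by lifting identity morphisms. *)
Lemma isomorphic_lift (a : T) : exists i (c : TT i), isomorphic (f i c) a.
Proof.
have [i [c [_ [_ [p [_ [piso _ _]]]]]]] := fsurj (idm a).
by exists i, c; apply: isomorphic_sym; exists p.
Qed.

Lemma isomorphic_lift2 (a b : T) :
  exists i (c d : TT i), isomorphic (f i c) a /\ isomorphic (f i d) b.
Proof.
have [i [c ca]] := isomorphic_lift a; have [j [d db]] := isomorphic_lift b.
have [k [[u] [v]]] := proj2 Iconj i j.
exists k, (pf_mor TT u c), (pf_mor TT v d).
by split; [apply: isomorphic_trans ca|apply: isomorphic_trans db];
  exact: isomorphic_pf_mor.
Qed.

Lemma Spc_isomorphic (S : ttcat) (P : Spc S) (a b : S) :
  isomorphic a b -> spc_set P a <-> spc_set P b.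
Proof.
have Piso := thick_iso (ideal_thick (prime_ideal (spc_prime P))).
by move=> ab; split; apply: Piso => //; exact: isomorphic_sym.
Qed.

Definition glued_set (x : forall i, Spc (TT i)) : set T :=
  [set a | exists i (c : TT i), spc_set (x i) c /\ isomorphic (f i c) a].

Variable x : forall i, Spc (TT i).
Hypothesis xcomp : compatible_primes x.

Lemma compatible_pf_mor (i j : I) (u : hom i j) (c : TT i) :
  spc_set (x i) c <-> spc_set (x j) (pf_mor TT u c).
Proof. by rewrite -(xcomp u). Qed.

Lemma glued_setE (i : I) (c : TT i) (a : T) :
  isomorphic (f i c) a -> glued_set x a <-> spc_set (x i) c.
Proof.
move=> ca; split; last by exists i, c.
move=> [j [d [xd da]]]; have [k [[u] [v]]] := proj2 Iconj i j.
(* Over [k] the two lifts [c] and [d] both become [a] in [T], so detection makes them isomorphic at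
   a further index [l]. *)
have [|l [w uv]] := @fdet k (pf_mor TT u c) (pf_mor TT v d).
  apply: isomorphic_trans (isomorphic_pf_mor u c) _.
  apply: isomorphic_trans ca _; apply: isomorphic_trans (isomorphic_sym da) _.
  exact: isomorphic_sym (isomorphic_pf_mor v d).
(* Membership is pushed from [i] through [k] to [l], exchanged there along [uv], and traced back to
   [d] at [j]. *)
apply/(compatible_pf_mor u)/(compatible_pf_mor w)/(Spc_isomorphic _ uv).
by do 2!apply: (iffLR (compatible_pf_mor _ _)).
Qed.

Lemma glued_set_isomorphic (a b : T) :
  isomorphic a b -> glued_set x a -> glued_set x b.
Proof.
by move=> ab [i [c [xc ca]]]; exists i, c; split=> //; exact: isomorphic_trans ab.
Qed.

(** Only the summands are lifted: the sum of the lifts is sent to a sum of [a] and [b], hence to an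
    object isomorphic to [c]. No lift of the splitting of [c] is required. *)
Lemma glued_set_direct_sum (a b c : T) :
  is_direct_sum a b c -> glued_set x c <-> glued_set x a /\ glued_set x b.
Proof.
move=> abc; have [i [a' [b' [a'a b'b]]]] := isomorphic_lift2 a b.
have [c' abc'] := direct_sum_ex a' b'.
have c'c := is_direct_sum_iso a'a b'b (ttf_is_direct_sum (f i) abc') abc.
rewrite (glued_setE a'a) (glued_setE b'b) (glued_setE c'c).
have thick := ideal_thick (prime_ideal (spc_prime (x i))).
split; [exact: thick_summand abc'|by case; exact: thick_sum abc'].
Qed.

Lemma glued_set_shift (a : T) : glued_set x (shift a) <-> glued_set x a.
Proof.
have [i [c ca]] := isomorphic_lift a.
have sca : isomorphic (f i (shift c)) (shift a).
  apply: isomorphic_trans (isomorphic_fobj shift ca).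
  by exists (ttf_shift (f i) c); exact: (exact_shift_iso (ttf_exact (f i))).
rewrite (glued_setE ca) (glued_setE sca).
exact: (thick_shift (ideal_thick (prime_ideal (spc_prime (x i))))).
Qed.

(** Only [g] is lifted. The exact functor [f i] sends a cone of the lift to a cone of its image,
    which is isomorphic to [c] by uniqueness of cones. *)
Lemma glued_set_cone (a b c : T)
    (g : hom a b) (h : hom b c) (k : hom c (shift a)) :
  distinguished g h k -> glued_set x a -> glued_set x b -> glued_set x c.
Proof.
move=> ghk; have [i [a' [b' [g' [p [q [piso qiso qg]]]]]]] := fsurj g.
have a'a : isomorphic (f i a') a by apply: isomorphic_sym; exists p.
have b'b : isomorphic (f i b') b by apply: isomorphic_sym; exists q.
have [c' [h' [k' ghk']]] := tr1_cone g'.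
have fghk' := exact_distinguished (ttf_exact (f i)) ghk'.
have c'c := isomorphic_sym (distinguished_cone_iso ghk fghk' piso qiso qg).
rewrite (glued_setE a'a) (glued_setE b'b) (glued_setE c'c).
exact: (thick_cone (ideal_thick (prime_ideal (spc_prime (x i)))) ghk').
Qed.

Lemma glued_set_zero (z : T) : is_zero_object z -> glued_set x z.
Proof.
move=> z0; have [[i] _] := Iconj; have [z' z'0] := zero_object_ex (TT i).
exists i, z'; split.
  exact: (thick_zero (ideal_thick (prime_ideal (spc_prime (x i))))).
by apply: zero_object_isomorphic => //; exact: ttf_is_zero_object.
Qed.

(** A common lift of both factors reduces the ideal axiom and primality alike to the prime [x i]. *)
Lemma glued_set_tens (a b : T) :
  exists i (c d : TT i), [/\ glued_set x a <-> spc_set (x i) c,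
    glued_set x b <-> spc_set (x i) d &
    glued_set x (a ⊗ b) <-> spc_set (x i) (c ⊗ d)].
Proof.
have [i [c [d [ca db]]]] := isomorphic_lift2 a b.
exists i, c, d; split; apply: glued_setE => //.
apply: isomorphic_trans (isomorphic_tens (tt_mon T) ca db).
by apply: isomorphic_sym; exists (ttf_tens (f i) c d); exact: ttf_tens_iso.
Qed.

Lemma glued_set_prime : is_prime (glued_set x).
Proof.
split; [split; [split|]| |].
- exact: glued_set_isomorphic.
- exact: glued_set_zero.
- by move=> a b c /glued_set_direct_sum E *; apply/E.
- exact: glued_set_shift.
- exact: glued_set_cone.
- by move=> a b c /glued_set_direct_sum E /E.
- move=> a b; have [i [c [d [_ -> ->]]]] := glued_set_tens a b.
  exact: (ideal_tens (prime_ideal (spc_prime (x i)))).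
(* If the glued set were everything, then so would be [x i], because each [c] is a lift of
   [f i c]. *)
- have [[i] _] := Iconj; apply: contra_neq (prime_proper (spc_prime (x i))).
  move=> PT; apply/seteqP; split=> // c _.
  by apply/(glued_setE (isomorphic_refl (f i c))); rewrite PT.
- move=> a b; have [i [c [d [-> -> ->]]]] := glued_set_tens a b.
  exact: (prime_tens (spc_prime (x i))).
Qed.

End GluedPrime.

(** * Continuity into and out of subspaces of products *)

Lemma prod_proj_continuous (J : Type) (K : J -> topologicalType) (j : J) :
  continuous (fun y : prod_topology K => y j).
Proof.
(* The product topology is the supremum of the initial topologies of the projections, so convergence
   in it is convergence in each of them. *)
move=> y A yA; have /cvg_sup/(_ j) : nbhs y --> y by exact: cvg_id.
by apply; exact: (@initial_continuous _ _ (fun z : forall j, K j => z j)).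
Qed.

Lemma prod_subtype_proj_continuous (J : Type) (K : J -> topologicalType)
    (A : set (prod_topology K)) (j : J) :
  continuous (fun y : set_type A => \val y j).
Proof.
move=> y; have valc : continuous (fun z : set_type A => \val z).
  exact: initial_continuous.
exact: (cvg_comp _ _ (valc y) (@prod_proj_continuous J K j _)).
Qed.

Lemma prod_topology_continuous (J : Type) (K : J -> topologicalType)
    (X : topologicalType) (h : X -> prod_topology K) :
  (forall j, continuous (fun p => h p j)) -> continuous h.
Proof.
move=> hc p; apply/cvg_sup => j.
exact: (@continuous_comp_initial _ _ _ (fun z : forall j, K j => z j) h).
Qed.

Theorem proposition8p5 (I : category) (TT : pseudofunctor I) (T : ttcat)
    (f : pseudococone TT T) :
  conjoining I -> surjective_on_morphisms f -> detects_isomorphisms f ->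
  is_homeomorphism (Spc_lim_map f).
Proof.
move=> Iconj fsurj fdet.
pose glue (x : Spc_lim TT) : Spc T :=
  MkSpc (glued_set_prime Iconj fsurj fdet (set_mem (valP x))).
have glueE (x : Spc_lim TT) i (c : TT i) (a : T) : isomorphic (f i c) a ->
    spc_set (glue x) a <-> spc_set (\val x i) c.
  exact: (glued_setE Iconj fdet (set_mem (valP x))).
exists glue; split.
- move=> P; apply: Spc_eq => a; have [i [c ca]] := isomorphic_lift fsurj a.
  by rewrite (glueE _ _ _ _ ca) /= (Spc_isomorphic P ca).
(* Each [c] in [TT i] lifts its own image [f i c], so pulling the glued prime back along [f i]
   returns [x i]. *)
- move=> x; apply: val_inj; apply: functional_extensionality_dep => i.
  apply: Spc_eq => c.
  exact: (glueE x i c _ (isomorphic_refl _)).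
- apply: continuous_comp_initial; apply: prod_topology_continuous => i.
  exact: Spc_map_continuous.
- apply/continuousP => A /Spc_openP[D ->]; rewrite preimage_bigcup.
  apply: bigcup_open => a _; have [i [c ca]] := isomorphic_lift fsurj a.
  (* For a lift [c] of [a] at index [i], the condition that the glued prime contains [a] involves
     only the coordinate [x i], so a basic open set pulls back to an open cylinder. *)
  have -> : glue @^-1` SpcU a = (fun x : Spc_lim TT => \val x i) @^-1` SpcU c.
    by apply/seteqP; split=> x /(glueE _ _ _ _ ca).
  have /continuousP : continuous (fun x : Spc_lim TT => \val x i).
    exact: prod_subtype_proj_continuous.
  by apply; apply/Spc_openP; exists [set c]; rewrite bigcup_set1.
Qed.
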